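(* Let $\alpha,\beta>0$, let $\frac{3-\sqrt5}{4}<b\le\frac14$ and set $$h_b:=\sqrt{\frac{4b^2-6b+1}{b^2(2b-1)}} .$$ Then the scheme $\mathbf{Y}_{n+1}=\Psi_h^{(b)}(\mathbf{Y}_n)$ with step size $h:=\alpha\,\beta\,h_b$, where $$\Psi_h^{(b)}:=\varphi^{[Q]}_{b h}\circ\varphi^{[P]}_{h/2}\circ\varphi^{[Q]}_{(1-2b)h}\circ\varphi^{[P]}_{h/2}\circ\varphi^{[Q]}_{b h},$$ provides a stable energy-preserving approximation of the test model $\frac{dQ}{dt}=\frac{P}{\beta^2}$, $\frac{dP}{dt}=-\frac{Q}{\alpha^2}$; that is, the scheme is stable and $H(\mathbf{Y}_{n+1})=H(\mathbf{Y}_n)$ for all $\mathbf{Y}_n\in\mathbb{R}^2$.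
   Context: Here $\mathbf{Y}=[Q,P]^T\in\mathbb{R}^2$ and the energy of the test model is $H(Q,P)=\frac12\left(\frac{Q^2}{\alpha^2}+\frac{P^2}{\beta^2}\right)$. The maps $\varphi^{[P]}_t$ and $\varphi^{[Q]}_t$ are the exact time-$t$ flows of $\frac{d\mathbf{Y}}{dt}=[P/\beta^2,\,0]^T$ and $\frac{d\mathbf{Y}}{dt}=[0,\,-Q/\alpha^2]^T$ respectively, i.e. $\varphi^{[P]}_t(Q,P)=(Q+tP/\beta^2,\,P)$ and $\varphi^{[Q]}_t(Q,P)=(Q,\,P-tQ/\alpha^2)$. On the test model the scheme is a linear map $\mathbf{Y}_{n+1}=M\mathbf{Y}_n$ where the $2\times2$ matrix $M$ has determinant $1$ and equal diagonal entries $M_{11}=M_{22}=\mathrm{p}$, with $\mathrm{p}=1-\frac{s^2}{2}+\frac{s^4}{4}b(1-2b)$, $s=\frac{h}{\alpha\beta}$; its eigenvalues solve $\lambda^2-2\mathrm{p}\lambda+1=0$. The scheme (its trajectories) is called stable when $\mathrm{p}^2-1<0$ (complex eigenvalues of modulus one) and unstable when $\mathrm{p}^2-1\ge0$.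
   Formalization: At b = 1/4 one has h_b² = 8 and p = −1, so p² − 1 = 0 and the scheme is not stable as defined; stability is stated only for b ≠ 1/4, at b = 1/4 the scheme is shown to be Y ↦ −Y, and energy preservation is stated on the full range. *)

(* Defs.v *)
From HB Require Import structures.
From mathcomp Require Import all_boot all_order all_algebra.
From mathcomp Require Import all_classical all_reals all_analysis.
From mathcomp Require Import ring lra.

Set Implicit Arguments.
Unset Strict Implicit.
Unset Printing Implicit Defensive.

Import Order.TTheory GRing.Theory Num.Theory.
Import numFieldNormedType.Exports.

Local Open Scope ring_scope.

(* A state [Q, P]^T of the phase plane. *)
Definition state (R : realType) (q p : R) : 'cV[R]_2 :=
  \col_(i < 2) (if i == 0 then q else p).

Definition posQ (R : realType) (Y : 'cV[R]_2) : R := Y 0 0.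
Definition momP (R : realType) (Y : 'cV[R]_2) : R := Y 1 0.

Definition energy (R : realType) (alpha beta : R) (Y : 'cV[R]_2) : R :=
  2^-1 * (posQ Y ^+ 2 / alpha ^+ 2 + momP Y ^+ 2 / beta ^+ 2).

Definition test_field (R : realType) (alpha beta : R) (Y : 'cV[R]_2) : 'cV[R]_2 :=
  state (momP Y / beta ^+ 2) (- posQ Y / alpha ^+ 2).

Definition fieldP (R : realType) (beta : R) (Y : 'cV[R]_2) : 'cV[R]_2 :=
  state (momP Y / beta ^+ 2) 0.

Definition fieldQ (R : realType) (alpha : R) (Y : 'cV[R]_2) : 'cV[R]_2 :=
  state 0 (- posQ Y / alpha ^+ 2).

Definition is_flow (R : realType) (f : 'cV[R]_2 -> 'cV[R]_2)
    (phi : R -> 'cV[R]_2 -> 'cV[R]_2) : Prop :=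
  forall Y : 'cV[R]_2,
    phi 0 Y = Y /\
    forall (t : R) (i : 'I_2),
      is_derive t (1 : R) (fun u : R => phi u Y i 0 : R) (f (phi t Y) i 0).

Definition flowP (R : realType) (beta t : R) (Y : 'cV[R]_2) : 'cV[R]_2 :=
  state (posQ Y + t * momP Y / beta ^+ 2) (momP Y).

Definition flowQ (R : realType) (alpha t : R) (Y : 'cV[R]_2) : 'cV[R]_2 :=
  state (posQ Y) (momP Y - t * posQ Y / alpha ^+ 2).

Definition Psi (R : realType) (alpha beta b h : R) : 'cV[R]_2 -> 'cV[R]_2 :=
  flowQ alpha (b * h) \o flowP beta (h / 2) \o
  flowQ alpha ((1 - 2 * b) * h) \o flowP beta (h / 2) \o flowQ alpha (b * h).

Definition step_b (R : realType) (b : R) : R :=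
  Num.sqrt ((4 * b ^+ 2 - 6 * b + 1) / (b ^+ 2 * (2 * b - 1))).

(* The common diagonal entry p of the matrix M of the scheme, in terms of
   s = h / (alpha * beta); see [Psi_matrix]. *)
Definition stab_coef (R : realType) (b s : R) : R :=
  1 - s ^+ 2 / 2 + s ^+ 4 / 4 * (b * (1 - 2 * b)).

(* The eigenvalues of M solve l^2 - 2 p l + 1 = 0 with p = M 0 0 = M 1 1;
   stability is p^2 - 1 < 0, so the parabolic case p = 1 or p = -1 counts as
   unstable, even when M is the identity or its opposite.  The latter occurs
   for Psi at b = 1/4, h = alpha * beta * step_b b = alpha * beta * sqrt 8, where
   p = -1 and Psi Y = - Y.  M is determined by Phi, so the existential is
   harmless. *)
Definition stable (R : realType) (Phi : 'cV[R]_2 -> 'cV[R]_2) : Prop :=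
  exists M : 'M[R]_2,
    [/\ forall Y : 'cV[R]_2, Phi Y = M *m Y,
        \det M = 1,
        M 0 0 = M 1 1
      & (M 0 0) ^+ 2 - 1 < 0].

Lemma posQ_state (R : realType) (q p : R) : posQ (state q p) = q.
Proof. by rewrite /posQ mxE. Qed.

Lemma momP_state (R : realType) (q p : R) : momP (state q p) = p.
Proof. by rewrite /momP mxE. Qed.

Lemma cV2P (R : realType) (Y Z : 'cV[R]_2) :
  posQ Y = posQ Z -> momP Y = momP Z -> Y = Z.
Proof.
move=> hq hp; apply/matrixP => i j; rewrite (ord1 j).
by case: (unliftP 0 i) => [k|] ->; rewrite ?(ord1 k) //;
  have -> : lift 0 0 = 1 :> 'I_2 by apply/val_inj.
Qed.

Lemma fieldPQ (R : realType) (alpha beta : R) (Y : 'cV[R]_2) :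
  fieldP beta Y + fieldQ alpha Y = test_field alpha beta Y.
Proof. by apply: cV2P; rewrite /posQ /momP !mxE /= ?addr0 ?add0r. Qed.

Lemma is_derive_affine (R : realType) (a c t : R) :
  is_derive t (1 : R) (fun u : R => a + u * c : R) c.
Proof.
have -> : (fun u : R => a + u * c : R) = cst a + c \*: (@id R).
  by apply/funext => u; rewrite /= mulrC.
by apply: is_derive_eq; rewrite add0r /GRing.scale /= mulr1.
Qed.

Lemma flowP_exact (R : realType) (beta : R) : is_flow (fieldP beta) (flowP beta).
Proof.
move=> Y; split=> [|t i].
  by apply: cV2P; rewrite ?posQ_state ?momP_state // !mul0r addr0.
rewrite /flowP /fieldP /state.
under [X in is_derive _ _ X _]eq_fun do rewrite mxE.
rewrite mxE momP_state.
case: ifP => _; last exact: is_derive_cst.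
under [X in is_derive _ _ X _]eq_fun do rewrite -mulrA.
exact: is_derive_affine.
Qed.

Lemma flowQ_exact (R : realType) (alpha : R) : is_flow (fieldQ alpha) (flowQ alpha).
Proof.
move=> Y; split=> [|t i].
  by apply: cV2P; rewrite ?posQ_state ?momP_state // !mul0r subr0.
rewrite /flowQ /fieldQ /state.
under [X in is_derive _ _ X _]eq_fun do rewrite mxE.
rewrite mxE posQ_state.
case: ifP => _; first exact: is_derive_cst.
under [X in is_derive _ _ X _]eq_fun do rewrite -mulrA -mulrN -mulNr.
exact: is_derive_affine.
Qed.

Lemma Psi_matrix (R : realType) (alpha beta b h : R) (M : 'M[R]_2)
    (halpha : 0 < alpha) (hbeta : 0 < beta)
    (hM : forall Y : 'cV[R]_2, Psi alpha beta b h Y = M *m Y) :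
  M 0 0 = stab_coef b (h / (alpha * beta)) /\
  M 1 1 = stab_coef b (h / (alpha * beta)).
Proof.
have ha : alpha != 0 by rewrite gt_eqF.
have hb : beta != 0 by rewrite gt_eqF.
have e1 : M 0 0 = posQ (Psi alpha beta b h (state 1 0)).
  by rewrite hM /posQ mxE !big_ord_recl big_ord0 !mxE /= mulr1 mulr0 !addr0.
have e2 : M 1 1 = momP (Psi alpha beta b h (state 0 1)).
  rewrite hM /momP mxE !big_ord_recl big_ord0 !mxE /= mulr0 mulr1 addr0 add0r.
  by congr (M _ _); apply/val_inj.
rewrite e1 e2 /Psi /= /flowQ /flowP ?(posQ_state, momP_state) /stab_coef.
by split; field; rewrite ha hb.
Qed.

(* Main.v *)
(* In the coordinates Q / alpha, P / beta the scheme has the matrix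
   [[p, m], [m', p]] of determinant 1, and H is half the squared norm, so H is
   preserved as soon as m' = - m.  With s = h / (alpha beta),
     m + m' = s^3 / 4 (b^2 (2b - 1) s^2 - (4b^2 - 6b + 1)),
   whose nonzero root is s = h_b.  For that s,
     p - 1 = (4b^2 - 6b + 1) (1 - 2b) / (4b^3) < 0   and
     p + 1 = (4b - 1)^2 / (4b^3),
   the latter being positive except at b = 1/4, where p = -1 and m = 0. *)
Require Import Defs.
From mathcomp Require Import all_boot all_order all_algebra.
From mathcomp Require Import all_classical all_reals all_analysis.
From mathcomp Require Import ring lra.

Import Order.TTheory GRing.Theory Num.Theory.
Local Open Scope ring_scope.

Definition off_coef {R : realType} (b s : R) : R :=
  s * (1 - s ^+ 2 / 4 * (1 - 2 * b)).

(** The condition m + m' = 0 without its factor s^3 / 4, kept free of division. *)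
Definition balanced {R : realType} (b s : R) : Prop :=
  b ^+ 2 * (2 * b - 1) * s ^+ 2 = 4 * b ^+ 2 - 6 * b + 1.

Lemma Psi_balanced {R : realType} {alpha beta b s : R} (Y : 'cV[R]_2) :
  0 < alpha -> 0 < beta -> balanced b s ->
  Psi alpha beta b (alpha * beta * s) Y =
  state (stab_coef b s * posQ Y + alpha / beta * off_coef b s * momP Y)
        (stab_coef b s * momP Y - beta / alpha * off_coef b s * posQ Y).
Proof.
move=> /lt0r_neq0 ha /lt0r_neq0 hb bal.
apply: cV2P; rewrite /Psi /= /flowQ /flowP ?(posQ_state, momP_state).
  by rewrite /stab_coef /off_coef; field; rewrite ha hb.
apply/eqP; rewrite -subr_eq0; apply/eqP.
(* Only the coefficient of Q can differ, by [beta / alpha] times m + m'. *)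
transitivity (beta / alpha * posQ Y * (s ^+ 3 / 4) *
  (b ^+ 2 * (2 * b - 1) * s ^+ 2 - (4 * b ^+ 2 - 6 * b + 1))).
  by rewrite /stab_coef /off_coef; field; rewrite ha hb.
by rewrite bal subrr mulr0.
Qed.

(** The determinant p^2 - m m' is identically 1, so p^2 + m^2 - 1 = m (m + m'). *)
Lemma stab_off_sqr {R : realType} {b s : R} :
  balanced b s -> stab_coef b s ^+ 2 + off_coef b s ^+ 2 = 1.
Proof.
move=> bal; apply/eqP; rewrite -subr_eq0; apply/eqP.
transitivity (off_coef b s * (s ^+ 3 / 4) *
  (b ^+ 2 * (2 * b - 1) * s ^+ 2 - (4 * b ^+ 2 - 6 * b + 1))).
  by rewrite /stab_coef /off_coef; field.
by rewrite bal subrr mulr0.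
Qed.

Lemma stab_coefD1 {R : realType} {b s : R} :
  0 < b < 2^-1 -> balanced b s ->
  stab_coef b s + 1 = (4 * b - 1) ^+ 2 / (4 * b ^+ 3).
Proof.
move=> /andP[b0 b2] bal.
have hb : b != 0 by rewrite gt_eqF.
have hc : 2 * b - 1 != 0 by rewrite lt_eqF //; lra.
(* Exposes p as a polynomial in [s ^+ 2], for which the balance equation is then solved. *)
have -> : stab_coef b s =
    1 - s ^+ 2 / 2 - (s ^+ 2) ^+ 2 / 4 * (b * (2 * b - 1)).
  by rewrite /stab_coef; ring.
have -> : s ^+ 2 = (4 * b ^+ 2 - 6 * b + 1) / (b ^+ 2 * (2 * b - 1)).
  by rewrite -bal; field; rewrite hc hb.
by field; rewrite hc hb.
Qed.

Lemma stab_coef_lt1 {R : realType} {b s : R} :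
  0 < b < 2^-1 -> s != 0 -> balanced b s -> stab_coef b s < 1.
Proof.
move=> /andP[b0 b2] s0 bal; rewrite -subr_gt0.
have hb : b != 0 by rewrite gt_eqF.
have -> : 1 - stab_coef b s = s ^+ 2 * (1 - 2 * b) ^+ 2 / (4 * b).
  (* By balance the bracket becomes 2b + 4b^2 - 6b + 1 = (1 - 2b)^2. *)
  transitivity (s ^+ 2 * (2 * b + b ^+ 2 * (2 * b - 1) * s ^+ 2) / (4 * b)).
    by rewrite /stab_coef; field.
  by rewrite bal; field.
have s2 : 0 < s ^+ 2 by rewrite exprn_even_gt0.
have c2 : 0 < (1 - 2 * b) ^+ 2 by rewrite exprn_gt0 //; lra.
by apply: divr_gt0; [exact: mulr_gt0 | lra].
Qed.

(** The quadratic has roots (3 - sqrt 5) / 4 > 0 and (3 + sqrt 5) / 4, and b lies strictly between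
    them. *)
Lemma step_b_numerator_lt0 {R : realType} {b : R} :
  (3 - Num.sqrt 5) / 4 < b -> b <= 1 / 4 ->
  0 < b /\ 4 * b ^+ 2 - 6 * b + 1 < 0.
Proof.
move=> lo hi.
have q2 : Num.sqrt (5 : R) ^+ 2 = 5 by rewrite sqr_sqrtr.
have q0 : 0 <= Num.sqrt (5 : R) by exact: sqrtr_ge0.
set q := Num.sqrt (5 : R) in lo q2 q0.
have q3 : q < 3 by nra.
have b0 : 0 < b by lra.
split=> //.
have -> : 4 * b ^+ 2 - 6 * b + 1 =
    (4 * b - 3 - q) * (4 * b - 3 + q) / 4 :> R.
  by rewrite -subr_sqr q2; field.
by rewrite pmulr_llt0 ?invr_gt0 // nmulr_rlt0; lra.
Qed.

Lemma step_b_balanced {R : realType} {b : R} :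
  0 < b < 2^-1 -> 4 * b ^+ 2 - 6 * b + 1 < 0 ->
  step_b b != 0 /\ balanced b (step_b b).
Proof.
move=> /andP[b0 b2] num0.
have den0 : b ^+ 2 * (2 * b - 1) < 0.
  by rewrite pmulr_rlt0 ?exprn_gt0 //; lra.
(* A negative radicand would make [Num.sqrt] return 0; here numerator and denominator are both
   negative. *)
have quot0 : 0 < (4 * b ^+ 2 - 6 * b + 1) / (b ^+ 2 * (2 * b - 1)).
  by rewrite nmulr_rgt0 // invr_lt0.
split; first by rewrite gt_eqF // sqrtr_gt0.
by rewrite /balanced /step_b sqr_sqrtr ?ltW // mulrC divfK // lt_eqF.
Qed.

Theorem theorem4p2 (R : realType) (alpha beta b : R)
    (halpha : 0 < alpha) (hbeta : 0 < beta)
    (hb_lower : (3 - Num.sqrt 5) / 4 < b) (hb_upper : b <= 1 / 4) :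
  let h := alpha * beta * step_b b in
  let Phi := Psi alpha beta b h in
  [/\ b != 1 / 4 -> stable Phi,
      b = 1 / 4 -> forall Y : 'cV[R]_2, Phi Y = - Y
    & forall Y : 'cV[R]_2, energy alpha beta (Phi Y) = energy alpha beta Y].
Proof.
have ha : alpha != 0 by rewrite gt_eqF.
have hb : beta != 0 by rewrite gt_eqF.
have [b0 num0] := step_b_numerator_lt0 hb_lower hb_upper.
have b01 : 0 < b < 2^-1 by rewrite b0 /=; lra.
have [s0 bal] := step_b_balanced b01 num0.
move=> h Phi; rewrite /Phi /h {h Phi}.
have PsiE Y := Psi_balanced Y halpha hbeta bal.
have pm1 := stab_off_sqr bal.
have p_gt := stab_coefD1 b01 bal.
have p_lt := stab_coef_lt1 b01 s0 bal.
move: (step_b b) PsiE pm1 p_gt p_lt => s.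
move: (stab_coef b s) (off_coef b s) => p m PsiE pm1 p_gt p_lt.
split.
- move=> b4.
  have p1 : 0 < p + 1.
    rewrite p_gt divr_gt0 //; last by rewrite mulr_gt0 ?ltr0n ?exprn_gt0.
    by rewrite exprn_even_gt0 //=; apply: contraNneq b4 => b4; apply/eqP; lra.
  (* The rotation [[p, m], [-m, p]] carried back from Q / alpha, P / beta to Q, P. *)
  pose M : 'M[R]_2 := \matrix_(i, j)
    (if i == j then p else if i == 0 then alpha / beta * m
     else - (beta / alpha * m)).
  exists M; split.
  + have lift00 : lift 0 0 = 1 :> 'I_2 by apply/val_inj.
    move=> Y; rewrite PsiE; apply: cV2P; rewrite ?posQ_state ?momP_state [RHS]mxE
      !big_ord_recl big_ord0 !mxE /= addr0 lift00 //.
    by rewrite mulNr addrC.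
  + rewrite (expand_det_row _ 0) !big_ord_recl big_ord0 /cofactor !det_mx11.
    by rewrite !mxE -[RHS]pm1 /bump /= expr0 expr1; field; rewrite ha hb.
  + by rewrite !mxE.
  + by rewrite mxE /=; nra.
- move=> b4 Y.
  have p1 : p = -1.
    apply/eqP; rewrite -subr_eq0 opprK p_gt b4.
    by have -> : 4 * (1 / 4) - 1 = 0 :> R; [field | rewrite expr0n mul0r].
  have m0 : m = 0.
    apply/eqP; rewrite -sqrf_eq0; apply/eqP; move: pm1; rewrite p1 sqrrN expr1n.
    by move=> e; lra.
  rewrite PsiE p1 m0; apply: cV2P; rewrite ?posQ_state ?momP_state;
    by rewrite !mulr0 !mul0r ?addr0 ?subr0 mulN1r /posQ /momP mxE.
- move=> Y; rewrite PsiE /energy !posQ_state !momP_state.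
  (* The cross terms in Q P cancel since the scaled off-diagonal entries are opposite. *)
  transitivity (2^-1 * (p ^+ 2 + m ^+ 2) *
    (posQ Y ^+ 2 / alpha ^+ 2 + momP Y ^+ 2 / beta ^+ 2)).
    by field; rewrite ha hb.
  by rewrite pm1 mulr1.
Qed.
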